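(* Let $P$ be an MINLP with $m$ constraints represented by expression trees $T_1,\dots,T_m$ all of whose operators are commutative. For $k\in[m]$, let $G_k=(V_k,E_k)$ be the colored graph derived from $T_k$ by the construction described in the context. Then, for every $k\in[m]$, $G_k$ is an anchored symmetry detection graph (SDG) for $P_k$. Moreover, $G_1,\dots,G_m$ are variable color compatible and (pairwise) constraint compatible.
   Context: Notation: $[n] = \{1,\dots,n\}$ and $[\pm n] = \{\pm 1,\dots,\pm n\}$ for a positive integer $n$; $\mathcal{S}_n$ is the symmetric group, acting on $\mathbb{R}^n$ by $\pi(x) = (x_{\pi^{-1}(1)},\dots,x_{\pi^{-1}(n)})$. MINLP: a problem $\min c^\top x$ subject to $g_k(x)\le 0$ for $k\in[m]$, $\ell_i\le x_i\le u_i$ for $i\in[n]$, and $x_i\in\mathbb{Z}$ for $i\in\mathcal{I}$, where $m,n$ are positive integers, $c\in\mathbb{R}^n$, $\mathcal{I}\subseteq[n]$, $g_k\colon\mathbb{R}^n\to\mathbb{R}$, $\ell_i\in\mathbb{R}\cup\{-\infty\}$, $u_i\in\mathbb{R}\cup\{+\infty\}$. For $k\in[m]$, $P_k$ denotes the MINLP obtained from $P$ by removing all constraints $g_1,\dots,g_m$ except $g_k$ (objective, bounds and integrality are kept). Reflections: the reflection center of variable $x_i$ is $\xi_i = \frac{\ell_i+u_i}{2}$ if both bounds are finite, and $\xi_i=0$ otherwise. A signed permutation is a bijection $\gamma\colon[\pm n]\to[\pm n]$ with $\gamma(-i)=-\gamma(i)$; these form the group $\mathcal{S}_n^{\pm}$.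 For $\gamma\in\mathcal{S}_n^{\pm}$ the reflection $\rho(\cdot;\gamma)\colon\mathbb{R}^n\to\mathbb{R}^n$ is $\rho(x;\gamma)_i = \xi_i+\operatorname{sgn}(\gamma^{-1}(i))\,(x_{|\gamma^{-1}(i)|}-\xi_{|\gamma^{-1}(i)|})$. $\gamma$ defines a reflection symmetry of an MINLP if for all $x\in\mathbb{R}^n$: $\rho(x;\gamma)$ is feasible if and only if $x$ is feasible, and $c^\top\rho(x;\gamma)=c^\top x$. Symmetry detection graph (SDG): let $P$ be an MINLP in $n$ variables and $G$ a node and edge colored connected graph containing pairwise distinct distinguished nodes $v_i$, $i\in[\pm n]$. $G$ is an SDG for $P$ if each color-preserving automorphism $\pi$ of $G$ satisfies: (1) $\pi$ keeps $\{v_i : i\in[\pm n]\}$ invariant; (2) if $\pi(v_i)=v_j$ for some $i,j\in[\pm n]$, then $\pi(v_{-i})=v_{-j}$; (3) the signed permutation $\gamma$ given by $\gamma(i)=j$ for the unique $j$ with $\pi(v_i)=v_j$, $i\in[\pm n]$, defines a reflection symmetry of $P$. Edges may be uncolored; being uncolored is preserved by color-preserving maps. Types: for $i\in[n]$, $x_{-i}$ denotes the reflection of $x_i$ at $\xi_i$, with lower bound $2\xi_i-u_i$, upper bound $2\xi_i-\ell_i$, and objective coefficient $c_{-i}=-c_i$. The type of $x_i$, $i\in[n]$, is $t(x_i)=(\ell_i-\xi_i,\,u_i-\xi_i,\,c_i,\,[i\in\mathcal{I}])$, and $t(x_{-i})=(\xi_i-u_i,\,\xi_i-\ell_i,\,-c_i,\,[i\in\mathcal{I}])$,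 where $[i\in\mathcal{I}]$ is the Boolean truth value. The set of variable colors is $\mathfrak{V}=\{t(x_i):i\in[\pm n]\}$. Variable color compatible: an SDG is variable color compatible if for each $i\in[\pm n]$ the distinguished node associated with $x_i$ is colored by $t(x_i)$, and no non-distinguished node has a color from $\mathfrak{V}$. Anchored: an SDG $G=(V,E)$ is anchored if there is a non-distinguished node $a\in V$ (an anchor) such that for each $v\in V\setminus\{a\}$ there is a path in $G$ from $a$ to $v$ none of whose interior nodes is a distinguished node. Constraint compatible: SDGs $G_k$ and $G_{k'}$ for $P_k$ and $P_{k'}$ are constraint compatible if they are non-isomorphic (as colored graphs) or $g_k\equiv g_{k'}$, where $g_k\equiv g_{k'}$ means that there is a permutation $\pi\in\mathcal{S}_n$ with $g_k(x)=g_{k'}(\pi(x))$ for all $x\in\mathbb{R}^n$. Expression trees: an expression tree $T_k$ for $g_k$ is an arborescence whose arcs point away from the root; each leaf is either a variable node (a variable occurring in $g_k$) or a value node (holding a numerical value); each non-leaf node $v$ is an operator node carrying a $d$-ary mathematical operator, $d$ being the number of children of $v$. Evaluating nodes bottom-up (leaves evaluate to their variable or value, operator nodes apply their operator to the functions of their children), the root evaluates to $g_k$. A variable may occur in several leaves. Preprocessing (all expression trees are assumed to incorporate these two modifications): (a) All reflection centers are moved to $0$: each variable $x_i$ is replaced by the shifted variable $x_i-\xi_i$ by setting its bounds to $\ell_i-\xi_i$ and $u_i-\xi_i$ and replacing in the trees every subtree representing an expression $\alpha\cdot x_i$, $\alpha\in\mathbb{R}$, by an expression tree for $\alpha\cdot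 x_i+\alpha\cdot\xi_i$. (b) Whenever an operator node $v$ is a multiplication with exactly two children, one a variable node $v_1$ and the other a value node $v_2$, then $v$ and $v_2$ are eliminated as follows: the coefficient (the value of $v_2$) is stored as a label on the arc leading to the variable node, i.e., $v_2$ is removed and its value is assigned to the arc entering $v_1$; so a summand $\alpha\cdot x_i$ is represented by a variable leaf $x_i$ joined to its parent operator by an arc with value $\alpha$. Colors: let $\mathfrak{N}'$ be the set of all numerical values used in the expression trees, $\mathfrak{N}=\{\pm v:v\in\mathfrak{N}'\}$ (the values $\pm1$ are also used as edge colors), $\mathfrak{O}$ the set of all operators appearing in the trees, and $\mathfrak{a}$ a symbol for anchors. The set of colors is $\mathfrak{C}=\mathfrak{N}\cup\mathfrak{O}\cup\mathfrak{V}\cup\{\mathfrak{a}\}$, where the different kinds of colors are distinct. Construction of $G_k$ from $T_k$: take an undirected copy $G'_k$ of $T_k$. Each node receives the color in $\mathfrak{C}$ corresponding to its type (its operator or its numerical value). If an arc has received a value in the preprocessing, the corresponding edge is colored by that value; each uncolored edge incident with a variable node receives the color of the numerical value $1$; all other edges remain uncolored. Add an anchor node $a$ of color $\mathfrak{a}$, joined by an edge to the root of the expression tree. For each variable $x_i$, $i\in[n]$, introduce two distinguished nodes $v^k_i$ and $v^k_{-i}$, colored $t(x_i)$ and $t(x_{-i})$, respectively, and joined by an (uncolored) edge $\{v^k_i,v^k_{-i}\}$. All nodes of $G'_k$ representing $x_i$ are removed, and every edge of $G'_k$ with color $c$ joining a node $v$ to a node representing $x_i$ is replaced by the two edges $\{v,v^k_i\}$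 of color $c$ and $\{v,v^k_{-i}\}$ of color $-c$. The resulting graph is $G_k$.
   Formalization: Added: integer variables of equal type have centers whose signed difference is an integer. Connected/anchored holds only up to variables absent from T_k. ≡ is via signed permutations; via plain ones only for centered constraints when no t(x_i) equals a t(x_{-j}). *)

(* Defs.v *)
From HB Require Import structures.
From mathcomp Require Import all_boot all_order all_algebra all_fingroup.
From mathcomp Require Import boolp constructive_ereal reals.

Set Implicit Arguments.
Unset Strict Implicit.
Unset Printing Implicit Defensive.

Import Order.TTheory GRing.Theory Num.Theory.
Local Open Scope ring_scope.

(** * Signed indices and signed permutations *)

(* [(i, false)] is +i and [(i, true)] is -i, so that the sign is
   [(-1) ^+ s.2]. *)
Notation signed n := ('I_n * bool)%type.

Definition sneg n (s : signed n) : signed n := (s.1, ~~ s.2).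

Definition signed_perm n (gamma : {perm signed n}) : Prop :=
  forall s, gamma (sneg s) = sneg (gamma s).

(** * Mixed-integer nonlinear programs *)

Record minlp (R : realType) (n m : nat) := Minlp {
  obj : 'rV[R]_n;
  con : 'I_m -> 'rV[R]_n -> R;
  lb : 'I_n -> \bar R;
  ub : 'I_n -> \bar R;
  ints : {set 'I_n};
  lb_neq_pinfty : forall i, lb i != +oo%E;
  ub_neq_ninfty : forall i, ub i != -oo%E }.

Section Minlp.
Variables (R : realType) (n : nat).

Definition objective m (P : minlp R n m) (x : 'rV[R]_n) : R :=
  \sum_(i < n) obj P 0 i * x 0 i.

Definition feasible m (P : minlp R n m) (x : 'rV[R]_n) : Prop :=
  [/\ forall k, con P k x <= 0,
      forall i, (lb P i <= (x 0 i)%:E <= ub P i)%E &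
      forall i, i \in ints P -> x 0 i \is a Num.int].

Definition only_con m (P : minlp R n m) (k : 'I_m) : minlp R n 1 :=
  @Minlp R n 1 (obj P) (fun _ => con P k) (lb P) (ub P) (ints P)
    (@lb_neq_pinfty _ _ _ P) (@ub_neq_ninfty _ _ _ P).

Definition center m (P : minlp R n m) (i : 'I_n) : R :=
  if (lb P i \is a fin_num) && (ub P i \is a fin_num)
  then (fine (lb P i) + fine (ub P i)) / 2 else 0.

Definition reflection m (P : minlp R n m) (gamma : {perm signed n})
    (x : 'rV[R]_n) : 'rV[R]_n :=
  \row_i let j := (gamma^-1)%g (i, false) in
         center P i + (-1) ^+ j.2 * (x 0 j.1 - center P j.1).

Definition reflection_symmetry m (P : minlp R n m) (gamma : {perm signed n}) :
    Prop :=
  forall x, (feasible P (reflection P gamma x) <-> feasible P x) /\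
            objective P (reflection P gamma x) = objective P x.

Definition vtype : Type := (\bar R * \bar R * R * bool)%type.

Definition var_type m (P : minlp R n m) (s : signed n) : vtype :=
  let i := s.1 in let xi := center P i in
  if s.2 then ((xi%:E - ub P i)%E, (xi%:E - lb P i)%E, - obj P 0 i, i \in ints P)
  else ((lb P i - xi%:E)%E, (ub P i - xi%:E)%E, obj P 0 i, i \in ints P).

(* A type records integrality only as the Boolean [i \in ints P], although in
   the centered coordinate [y_i = x_i - center P i] the constraint reads
   [y_i + center P i \is a Num.int].  The following says that these lattices
   agree for signed variables of equal type.  It holds if all finite bounds of
   integer variables are integers, if all centers are 0, and if there is no
   integer variable.  It can fail otherwise: for an integer variable with
   bounds [0, 1/2] and zero cost, [x] and its reflection [1/2 - x] have the
   same type, but reflecting does not preserve integrality. *)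
Definition types_respect_integrality m (P : minlp R n m) : Prop :=
  forall s s' : signed n, s.1 \in ints P -> var_type P s = var_type P s' ->
    (-1) ^+ s.2 * center P s.1 - (-1) ^+ s'.2 * center P s'.1 \is a Num.int.

(* The constraint function in the centered coordinates [y = x - center]. *)
Definition centered_con m (P : minlp R n m) (k : 'I_m) (y : 'rV[R]_n) : R :=
  con P k (\row_i (y 0 i + center P i)).

Definition permute (pi : 'S_n) (x : 'rV[R]_n) : 'rV[R]_n :=
  \row_i x 0 ((pi^-1)%g i).

Definition perm_equiv (g g' : 'rV[R]_n -> R) : Prop :=
  exists pi : 'S_n, forall x, g x = g' (permute pi x).

(* Signed version of [perm_equiv], along the reflections of [P].  Isomorphisms
   of colored graphs cannot distinguish a variable from its reflection if both
   have the same type: for a free variable with zero cost, the graphs of x and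
   -x are isomorphic, although no permutation maps x to -x. *)
Definition reflection_equiv m (P : minlp R n m) (g g' : 'rV[R]_n -> R) : Prop :=
  exists gamma : {perm signed n},
    signed_perm gamma /\ forall x, g x = g' (reflection P gamma x).

End Minlp.

(** * Colored graphs *)

(* Undirected multigraphs: parallel edges are needed because a variable may
   occur several times below the same operator, as in [x + x] or [2x + 3x].
   An edge color [None] means that the edge is uncolored. *)
Record cgraph (C : Type) := CGraph {
  node : finType;
  edge : finType;
  ends : edge -> node * node;
  ncol : node -> C;
  ecol : edge -> option C }.

Section Graph.
Variable C : Type.

Definition endset (G : cgraph C) (e : edge G) : {set node G} :=
  [set (ends e).1; (ends e).2].

Definition adj (G : cgraph C) : rel (node G) :=
  fun u w => [exists e, endset e == [set u; w]].

Definition connected (G : cgraph C) : Prop := forall u w, connect (@adj G) u w.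

Definition isomorphism (G G' : cgraph C) (f : node G -> node G') : Prop :=
  [/\ bijective f, (forall u, ncol (f u) = ncol u) &
      exists h : edge G -> edge G',
        [/\ bijective h, forall e, endset (h e) = f @: endset e &
            forall e, ecol (h e) = ecol e]].

Definition isomorphic (G G' : cgraph C) : Prop :=
  exists f : node G -> node G', isomorphism f.

End Graph.

(** * Symmetry detection graphs *)

Section Sdg.
Variables (R : realType) (n : nat) (C : Type) (G : cgraph C).
Variable v : signed n -> node G.

Definition distinguished : {set node G} := [set v s | s : signed n].

Definition automorphisms_are_symmetries m (P : minlp R n m) : Prop :=
  forall pi : node G -> node G, isomorphism pi ->
    [/\ pi @: distinguished = distinguished,
        (forall s s', pi (v s) = v s' -> pi (v (sneg s)) = v (sneg s')) &
        exists gamma : {perm signed n},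
          [/\ signed_perm gamma, forall s, pi (v s) = v (gamma s) &
              reflection_symmetry P gamma]].

Definition is_sdg m (P : minlp R n m) : Prop :=
  [/\ connected G, injective v & automorphisms_are_symmetries P].

Definition inner_path (a u : node G) : Prop :=
  exists p, path (@adj _ G) a (rcons p u) /\
            forall w, w \in p -> w \notin distinguished.

Definition anchored : Prop :=
  exists a, a \notin distinguished /\ forall u, u != a -> inner_path a u.

(* [anchored], but without requiring the nodes [v s] with [~~ used s.1] to be
   reachable from the anchor.  For a variable not occurring in an expression
   tree, the two distinguished nodes form a component of their own. *)
Definition anchored_on (used : pred 'I_n) : Prop :=
  exists a, a \notin distinguished /\
    forall u, u != a -> (forall s, u = v s -> used s.1) -> inner_path a u.

End Sdg.

Definition constraint_compatible C (G G' : cgraph C) (equiv : Prop) : Prop :=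
  ~ isomorphic G G' \/ equiv.

(** * Expression trees *)

(* An operator is a symbol interpreted as a function of the list of its
   arguments, that is, as one function for each arity. *)
Record operators (R : realType) := Operators {
  opsym : choiceType;
  interp : opsym -> seq R -> R }.

(* [Var a i] is a leaf for variable [i] whose incoming arc has label [a]; an
   unlabelled arc is represented by [a = 1], the color it gets in the graph. *)
Inductive expr (R : realType) (O : operators R) (n : nat) : Type :=
| Var of R & 'I_n
| Val of R
| App of opsym O & seq (expr O n).
Arguments Var {R O n}.
Arguments Val {R O n}.
Arguments App {R O n}.

Section Expr.
Variables (R : realType) (O : operators R) (n : nat).
Implicit Types t : expr O n.

Fixpoint eval (x : 'rV[R]_n) t : R :=
  match t with
  | Var a i => a * x 0 i
  | Val b => b
  | App o ts => interp o [seq eval x t' | t' <- ts]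
  end.

Definition represents t (g : 'rV[R]_n -> R) : Prop := forall x, eval x t = g x.

Fixpoint occurs (i : 'I_n) t : bool :=
  match t with
  | Var _ j => i == j
  | Val _ => false
  | App _ ts => has (occurs i) ts
  end.

Definition commutative_at (o : opsym O) (d : nat) : Prop :=
  forall s s' : seq R, size s = d -> perm_eq s s' -> interp o s = interp o s'.

Inductive commutative_tree : expr O n -> Prop :=
| commutative_Var a i : commutative_tree (Var a i)
| commutative_Val b : commutative_tree (Val b)
| commutative_App o ts :
    commutative_at o (size ts) ->
    (forall k, (k < size ts)%N -> commutative_tree (nth (Val 0) ts k)) ->
    commutative_tree (App o ts).

(* Modification (a): subtrees for [a * x_i] are replaced by arbitrary trees for
   [a * x_i + a * xi_i].  As there is no rule for keeping a variable leaf, every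
   variable leaf lies in a replaced subtree. *)
Inductive shifted (xi : 'I_n -> R) : expr O n -> expr O n -> Prop :=
| shifted_monomial a i t t' :
    (forall x, eval x t = a * x 0 i) ->
    (forall x, eval x t' = a * x 0 i + a * xi i) ->
    shifted xi t t'
| shifted_Val b : shifted xi (Val b) (Val b)
| shifted_App o ts ts' :
    size ts = size ts' ->
    (forall k, (k < size ts)%N ->
       shifted xi (nth (Val 0) ts k) (nth (Val 0) ts' k)) ->
    shifted xi (App o ts) (App o ts').

Definition is_mul (o : opsym O) : bool :=
  `[< forall a b : R, interp o [:: a; b] = a * b >].

(* Modification (b), bottom-up. *)
Fixpoint absorb t : expr O n :=
  match t with
  | App o ts =>
    let ts' := [seq absorb t' | t' <- ts] in
    if is_mul o then
      match ts' with
      | [:: Var a i; Val b] | [:: Val b; Var a i] => Var (a * b) i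
      | _ => App o ts'
      end
    else App o ts'
  | _ => t
  end.

Definition preprocessed m (P : minlp R n m) t t' : Prop :=
  exists t1, shifted (center P) t t1 /\ t' = absorb t1.

(** * The graph of an expression tree *)

(* A tree node is identified by the list of child indices on the path to it
   from the root, and comes together with its content. *)
Definition below A (ss : seq (seq (seq nat * A))) : seq (seq nat * A) :=
  flatten [seq [seq (ks.1 :: q.1, q.2) | q <- ks.2] |
               ks <- zip (iota 0 (size ss)) ss].

Fixpoint tree_nodes t : seq (seq nat * (R + opsym O)) :=
  match t with
  | Var _ _ => [::]
  | Val b => [:: ([::], inl b)]
  | App o ts => ([::], inr o) :: below [seq tree_nodes t' | t' <- ts]
  end.

Fixpoint var_leaves t : seq (seq nat * (R * 'I_n)) :=
  match t with
  | Var a i => [:: ([::], (a, i))]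
  | Val _ => [::]
  | App _ ts => below [seq var_leaves t' | t' <- ts]
  end.

Inductive color : Type :=
| CNum of R
| COp of opsym O
| CVar of vtype R
| CAnchor.

(* [None] is the anchor. *)
Definition gnode t : finType := option (signed n + seq_sub (tree_nodes t)).

Definition anchor_node t : gnode t := None.
Definition dist_node t (s : signed n) : gnode t := Some (inl s).
Definition inner_node t (q : seq_sub (tree_nodes t)) : gnode t := Some (inr q).

(* The tail of the arc entering position [p]; the root hangs from the anchor. *)
Definition parent_node t (p : seq nat) : gnode t :=
  if [pick q : seq_sub (tree_nodes t) |
        (p != [::]) && ((ssval q).1 == take (size p).-1 p)] is Some q
  then inner_node q else anchor_node t.

(* The edges are the pairs {v_i, v_-i}, the arcs entering operator and value
   nodes, and two edges for each arc entering a variable leaf.  This last rule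
   includes the arc from the anchor when the root is a variable leaf. *)
Definition gedge t : finType :=
  ('I_n + seq_sub (tree_nodes t) + seq_sub (var_leaves t) * bool)%type.

Definition gends t (e : gedge t) : gnode t * gnode t :=
  match e with
  | inl (inl i) => (dist_node t (i, false), dist_node t (i, true))
  | inl (inr q) => (parent_node t (ssval q).1, inner_node q)
  | inr (l, b) => (parent_node t (ssval l).1, dist_node t ((ssval l).2.2, b))
  end.

Definition gncol m (P : minlp R n m) t (u : gnode t) : color :=
  match u with
  | None => CAnchor
  | Some (inl s) => CVar (var_type P s)
  | Some (inr q) =>
    match (ssval q).2 with inl b => CNum b | inr o => COp o end
  end.

Definition gecol t (e : gedge t) : option color :=
  match e with
  | inl _ => None
  | inr (l, b) => Some (CNum ((-1) ^+ b * (ssval l).2.1))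
  end.

Definition tree_graph m (P : minlp R n m) t : cgraph color :=
  @CGraph color (gnode t) (gedge t) (@gends t) (gncol P (t := t)) (@gecol t).

Definition variable_color_compatible m (P : minlp R n m) (G : cgraph color)
    (v : signed n -> node G) : Prop :=
  (forall s, ncol (v s) = CVar (var_type P s)) /\
  (forall u, u \notin distinguished v -> forall s, ncol u <> CVar (var_type P s)).

End Expr.

(* Main.v *)
Require Import Defs.
From mathcomp Require Import all_boot all_order all_algebra all_fingroup.
From mathcomp Require Import boolp constructive_ereal reals.
From mathcomp Require Import zify ring lra.
Import GRing.Theory Num.Theory.
Local Open Scope ring_scope.
Set Implicit Arguments.
Unset Strict Implicit.
Unset Printing Implicit Defensive.

(** An isomorphism [f] from the graph of a tree [t] to the graph of a tree [t']
    determines everything needed, and both the automorphisms of one graph and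
    the isomorphisms between two graphs are instances of it.

    Colors force [f] to map the anchor to the anchor, distinguished nodes to
    distinguished nodes of the same type and inner nodes to inner nodes with
    the same content.  The uncolored edges between distinguished nodes are the
    pairs {v_i, v_-i}, so [f] acts on distinguished nodes as a signed
    permutation [gamma] that preserves types ([iso_signed_perm]).  Since the
    tree is rooted at the anchor, which is fixed, [f] respects the orientation
    of the arcs entering inner nodes ([iso_parent_inner]); the variable leaves
    have been merged into distinguished nodes, but each of them is remembered
    by its pair of colored edges, so [f] extends to a bijection between the
    places of the two trees that commutes with taking parents ([iso_place]).
    A leaf a x_i is sent to a leaf a' x_j whose value at the vector moved by
    [gamma] is the value of a x_i at the original vector, because the edge to
    v_-i carries the coefficient -a.  By induction on subtrees, commutativity
    of the operators absorbing the reordering of the children, [t'] evaluated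
    at the moved vector equals [t] evaluated at the original one ([iso_eval]).

    After preprocessing a tree evaluates to its constraint function in the
    coordinates centered at the reflection centers ([eval_preprocessed]), and
    in these coordinates the reflection of [gamma] is the plain signed action.
    So [f] translates into an identity between constraint functions; preserved
    types take care of bounds, integrality and objective
    ([type_preserving_reflection_symmetry]).  If no variable has the type of a
    reflected one, then [gamma] involves no sign and is a permutation.

    The graph is anchored because the path down the tree from the anchor to an
    inner node, or to the parent of a variable leaf, meets inner nodes only;
    variable color compatibility can be read off from the coloring. *)

(** * Expression trees and preprocessing *)

Section Trees.
Variables (R : realType) (O : operators R) (n : nat).
Implicit Types (t u : expr O n) (p : seq nat) (x y : 'rV[R]_n).

(** The automatically generated induction principle gives no hypothesis for the
    children of an operator node. *)
Lemma expr_nested_ind (Pr : expr O n -> Prop) :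
  (forall a i, Pr (Var a i)) -> (forall b, Pr (Val b)) ->
  (forall o ts, (forall k, (k < size ts)%N -> Pr (nth (Val 0) ts k)) ->
     Pr (App o ts)) ->
  forall t, Pr t.
Proof.
move=> hVar hVal hApp; fix ih 1 => -[a i|b|o ts].
- exact: hVar.
- exact: hVal.
- apply: hApp; elim: ts => [|t ts iht] k; first by clear ih; rewrite ltn0.
  by case: k => [_|k ltk]; [exact: (ih t)|exact: iht ltk].
Qed.

Lemma eval_absorb x t : eval x (absorb t) = eval x t.
Proof.
elim/expr_nested_ind: t => // o ts ih /=.
have <- : [seq eval x t' | t' <- [seq absorb t' | t' <- ts]]
          = [seq eval x t' | t' <- ts].
  rewrite -map_comp; apply: (@eq_from_nth _ 0); rewrite ?size_map // => k ltk.
  by rewrite !(nth_map (Val 0)) //= ih.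
case: ifP => // /asboolP mulE.
case: {ih}[seq _ | _ <- _] =>
    [|[a i|b|o1 ts1] [|[a' i'|b'|o2 ts2] [|u us]]] //=;
  by rewrite mulE; ring.
Qed.

Lemma eval_shifted (xi : 'I_n -> R) t t' y : shifted xi t t' ->
  eval y t' = eval (\row_i (y 0 i + xi i)) t.
Proof.
elim=> {t t'} [a i t t' tE t'E|//|o ts ts' szE _ ih /=].
  by rewrite tE t'E mxE mulrDr.
congr interp; apply: (@eq_from_nth _ 0); rewrite !size_map // => k ltk.
by rewrite !(nth_map (Val 0)) ?szE // ih // szE.
Qed.

(** Preprocessing moves the reflection centers to the origin. *)
Lemma eval_preprocessed m (P : minlp R n m) k t t' y :
  represents t (con P k) -> preprocessed P t t' ->
  eval y t' = centered_con P k y.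
Proof.
move=> tE [t1 [sh ->]].
by rewrite eval_absorb (eval_shifted _ sh) tE.
Qed.

(** * Positions in an expression tree *)

(** The subtree of [t] at the position [p], a list of child indices read from
    the root; [None] if there is no such position. *)
Fixpoint subtree t p : option (expr O n) :=
  if p is k :: p' then
    if t is App _ ts then
      if (k < size ts)%N then subtree (nth (Val 0) ts k) p' else None
    else None
  else Some t.

Lemma subtree_rcons t p k : subtree t (rcons p k) =
  if subtree t p is Some (App _ ts) then
    if (k < size ts)%N then Some (nth (Val 0) ts k) else None
  else None.
Proof. by elim: p t => [|j p ih] [] //= _ ts; case: ifP. Qed.

(** The content of the root of [t]: a value or an operator on the left, the
    coefficient and the index of a variable leaf on the right. *)
Definition label t : (R + opsym O) + (R * 'I_n) :=
  match t with
  | Var a i => inr (a, i)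
  | Val b => inl (inl b)
  | App o _ => inl (inr o)
  end.

Lemma below_nil (A : eqType) (ss : seq (seq (seq nat * A))) (c : A) :
  ([::], c) \notin below ss.
Proof.
apply/negP => /flattenP[s /mapP[ks _ ->]].
by case/mapP.
Qed.

Lemma mem_below (A : eqType) (ss : seq (seq (seq nat * A))) k p (c : A) :
  ((k :: p, c) \in below ss) = ((p, c) \in nth [::] ss k).
Proof.
rewrite /below; suff main j : ((k :: p, c) \in flatten
   [seq [seq (ks.1 :: q.1, q.2) | q <- ks.2] | ks <- zip (iota j (size ss)) ss])
  = (j <= k)%N && ((p, c) \in nth [::] ss (k - j)).
  by rewrite main leq0n subn0.
elim: ss j => [|s ss ih] j /=; first by rewrite nth_nil in_nil andbF.
rewrite mem_cat ih.
have -> : ((k :: p, c) \in [seq (j :: q.1, q.2) | q <- s])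
          = (k == j) && ((p, c) \in s).
  apply/mapP/andP => [[[q d] qs [-> -> ->]]|[/eqP-> ps]].
    by rewrite eqxx.
  by exists (p, c).
case: ltngtP => [lt|//|<-] /=; last by rewrite subnn orbF.
by have -> : (k - j)%N = (k - j.+1).+1 by lia.
Qed.

(** The two enumerations of positioned contents agree with [subtree]; hence a
    position determines its content. *)
Lemma mem_tree_nodes t p c :
  ((p, c) \in tree_nodes t) = (omap label (subtree t p) == Some (inl c)).
Proof.
elim/expr_nested_ind: t p c => [a i|b|o ts ih] [|k p] c //=.
- by rewrite inE xpair_eqE /= eq_sym.
- by rewrite in_cons (negPf (below_nil _ _)) orbF xpair_eqE /= eq_sym.
- rewrite in_cons xpair_eqE /= mem_below.
  have [ltk|gek] := ltnP; last by rewrite nth_default ?size_map.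
  by rewrite (nth_map (Val 0)) ?ih.
Qed.

Lemma mem_var_leaves t p c :
  ((p, c) \in var_leaves t) = (omap label (subtree t p) == Some (inr c)).
Proof.
elim/expr_nested_ind: t p c => [a i|b|o ts ih] [|k p] c //=.
- by rewrite inE xpair_eqE /= eq_sym.
- by rewrite (negPf (below_nil _ _)).
- rewrite mem_below.
  have [ltk|gek] := ltnP; last by rewrite nth_default ?size_map.
  by rewrite (nth_map (Val 0)) ?ih.
Qed.

Lemma subtree_occurs i t : occurs i t -> exists p a, subtree t p = Some (Var a i).
Proof.
elim/expr_nested_ind: t => [a j /= /eqP->|//|o ts ih /=].
  by exists [::], a.
move=> /(has_nthP (Val 0))[k ltk /(ih _ ltk)[p [a pE]]].
by exists (k :: p), a; rewrite /= ltk.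
Qed.

Lemma commutative_subtree t p u :
  commutative_tree t -> subtree t p = Some u -> commutative_tree u.
Proof.
elim: p t => [|k p ih] t ct /=; first by case=> <-.
case: ct => // o ts _ cts.
by case: ifP => // ltk; apply: ih; apply: cts.
Qed.

Section Position.
Variable t : expr O n.

(** All nodes of the tree, variable leaves included.  In the graph the variable
    leaves survive only through their edges. *)
Definition place : finType :=
  (seq_sub (tree_nodes t) + seq_sub (var_leaves t))%type.

Definition position (z : place) : seq nat :=
  match z with inl q => (ssval q).1 | inr l => (ssval l).1 end.

Definition place_label (z : place) : (R + opsym O) + (R * 'I_n) :=
  match z with inl q => inl (ssval q).2 | inr l => inr (ssval l).2 end.

(** The graph node above a place: the anchor for the root of the tree. *)
Definition parent (z : place) : gnode t := parent_node t (position z).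

Lemma omap_label_position z :
  omap label (subtree t (position z)) = Some (place_label z).
Proof.
case: z => [[[p c] in_t]|[[p c] in_t]] /=; apply/eqP.
- by rewrite -mem_tree_nodes.
- by rewrite -mem_var_leaves.
Qed.

Lemma subtree_position z :
  exists2 u, subtree t (position z) = Some u & label u = place_label z.
Proof.
have := omap_label_position z.
by case: subtree => [u [<-]|//]; exists u.
Qed.

Lemma position_inj : injective position.
Proof.
move=> z z' eq_zz'.
have := omap_label_position z; rewrite eq_zz' omap_label_position => -[].
case: z z' eq_zz' => [[[p c] ?]|[[p c] ?]] [[[p' c'] ?]|[[p' c'] ?]] //= eqp [eqc];
  by congr (_ _); apply: val_inj; rewrite /= eqp eqc.
Qed.

Lemma position_onto p u : subtree t p = Some u -> exists z, position z = p.
Proof.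
move=> pE; case lE: (label u) => [c|c].
- have in_t : (p, c) \in tree_nodes t by rewrite mem_tree_nodes pE /= lE.
  by exists (inl (SeqSub in_t)).
- have in_t : (p, c) \in var_leaves t by rewrite mem_var_leaves pE /= lE.
  by exists (inr (SeqSub in_t)).
Qed.

Lemma parent_node_rcons q k :
  parent_node t (rcons (position (inl q)) k) = inner_node q.
Proof.
rewrite /parent_node; case: pickP => [r|/(_ q)];
  rewrite size_rcons /= -cats1 take_size_cat //.
  move=> /andP[_ /eqP eq_rq]; congr inner_node.
  by have /(_ (inl r) (inl q) eq_rq)[] := position_inj.
by rewrite eqxx andbT; case: (ssval q).1.
Qed.

(** A position is empty or extends the position of an operator node: variable
    leaves have no children. *)
Lemma position_cases z : position z = [::] \/
  exists q k, position z = rcons (position (inl q)) k.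
Proof.
have [u + _] := subtree_position z.
case/lastP: (position z) => [|p k]; first by left.
rewrite subtree_rcons; case pE: subtree => [[| |o ts]|] // _.
right; have [[q|l] zE] := position_onto pE.
  by exists q, k; rewrite zE.
by have [v] := subtree_position (inr l); rewrite zE pE => -[<-].
Qed.

Lemma parent_eq_anchor z : parent z = anchor_node t <-> position z = [::].
Proof.
rewrite /parent; split=> [|->]; last by rewrite /parent_node; case: pickP.
by case: (position_cases z) => // -[q [k ->]]; rewrite parent_node_rcons.
Qed.

Lemma parent_eq_inner z q : parent z = inner_node q <->
  exists k, position z = rcons (position (inl q)) k.
Proof.
rewrite /parent; split=> [|[k ->]]; last exact: parent_node_rcons.
case: (position_cases z) => [/parent_eq_anchor|]; first by rewrite /parent => ->.
by case=> r [k ->]; rewrite parent_node_rcons => -[<-]; exists k.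
Qed.

(** The value at [x] of the subtree rooted at a place. *)
Definition value x (z : place) : R := oapp (eval x) 0 (subtree t (position z)).

(** The arguments of an operator node can be read off from the parent function
    alone, up to their order. *)
Lemma perm_children x q o ts : subtree t (position (inl q)) = Some (App o ts) ->
  perm_eq [seq eval x u | u <- ts]
          [seq value x z | z <- enum place & parent z == inner_node q].
Proof.
move=> qE; set p := position _ in qE.
pose val_at p' := oapp (eval x) 0 (subtree t p').
have -> : [seq eval x u | u <- ts] =
    [seq val_at p' | p' <- [seq rcons p k | k <- iota 0 (size ts)]].
  rewrite -map_comp; apply: (@eq_from_nth _ 0); rewrite !size_map ?size_iota //.
  move=> k ltk; rewrite (nth_map (Val 0)) // (nth_map 0%N) ?size_iota //=.
  by rewrite nth_iota // add0n /val_at subtree_rcons qE ltk.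
rewrite [X in perm_eq _ X](map_comp val_at position); apply: perm_map.
apply: uniq_perm.
- rewrite map_inj_uniq ?iota_uniq // => k k' eq_kk'.
  by have [] := rcons_inj eq_kk'.
- by rewrite (map_inj_uniq position_inj) filter_uniq ?enum_uniq.
move=> p'; apply/mapP/mapP => [[k]|[z]].
- rewrite mem_iota add0n /= => ltk ->.
  have /position_onto[z zE] : subtree t (rcons p k) = Some (nth (Val 0) ts k).
    by rewrite subtree_rcons qE ltk.
  exists z => //; rewrite mem_filter mem_enum andbT.
  by apply/eqP/parent_eq_inner; exists k.
- rewrite mem_filter => /andP[/eqP/parent_eq_inner[k zE] _] ->.
  exists k => //; have [u + _] := subtree_position z.
  by rewrite zE subtree_rcons qE mem_iota add0n /=; case: ifP.
Qed.

End Position.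

End Trees.

(** * Signed permutations acting by reflections *)

Section Reflections.
Variables (R : realType) (n : nat).
Implicit Types (gamma : {perm signed n}) (x y : 'rV[R]_n).

(** The reflection of [gamma] when all reflection centers are 0. *)
Definition signed_act gamma y : 'rV[R]_n :=
  \row_i let j := (gamma^-1)%g (i, false) in (-1) ^+ j.2 * y 0 j.1.

(** With y_s standing for the signed coordinate of index [s], the action of
    [gamma] carries y_s to the index [gamma s]. *)
Lemma signed_actE gamma y s : signed_perm gamma ->
  (-1) ^+ (gamma s).2 * signed_act gamma y 0 (gamma s).1 = (-1) ^+ s.2 * y 0 s.1.
Proof.
move=> sgamma; rewrite mxE; case gsE: (gamma s) => [i [|]] /=.
- have -> : (gamma^-1)%g (i, false) = sneg s.
    by apply: (canLR (permK gamma)); rewrite sgamma gsE.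
  by rewrite /= signrN mulrA expr1 mulrN mulN1r opprK.
- have -> : (gamma^-1)%g (i, false) = s by apply: (canLR (permK gamma)).
  by rewrite expr0 mul1r.
Qed.

Lemma signed_index_bij gamma : signed_perm gamma ->
  bijective (fun i => ((gamma^-1)%g (i, false)).1).
Proof.
move=> sgamma; apply: injF_bij => i i' eq_ii'.
have := permKV gamma (i, false); have := permKV gamma (i', false).
case: (_ (i, false)) (_ (i', false)) eq_ii' => [j b] [j' b'] /= <-.
case: (eqVneq b b') => [<- -> [->]//|neq_b].
have -> : (j, b) = sneg (j, b') :> signed n.
  by rewrite /sneg /=; case: b b' neq_b => [] [].
by rewrite sgamma => ->.
Qed.

Variables (m : nat) (P : minlp R n m).

(** [gamma] maps each signed variable to one of the same type. *)
Definition type_preserving gamma := forall s, var_type P (gamma s) = var_type P s.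

(** The coordinates of [x] relative to the reflection centers. *)
Definition centered x : 'rV[R]_n := \row_i (x 0 i - center P i).

Lemma reflectionE gamma x i :
  reflection P gamma x 0 i = signed_act gamma (centered x) 0 i + center P i.
Proof. by rewrite mxE [X in _ = X + _]mxE /= mxE addrC. Qed.

Lemma centered_reflection gamma x :
  centered (reflection P gamma x) = signed_act gamma (centered x).
Proof. by apply/rowP => i; rewrite mxE reflectionE addrK. Qed.

Lemma con_centered k x : con P k x = centered_con P k (centered x).
Proof. by congr con; apply/rowP => i; rewrite !mxE subrK. Qed.

(** The four lemmas below rewrite a bound on c + y as a bound on y or on -y, in
    the form in which types record bounds. *)
Lemma lower_shift (l : \bar R) (c y : R) :
  (l <= (c + y)%:E)%E = (l - c%:E <= y%:E)%E.
Proof.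
case: l => [l| |]; rewrite ?leey ?leNye //=.
by rewrite -EFinD !lee_fin; apply/idP/idP; lra.
Qed.

Lemma upper_shift (l : \bar R) (c y : R) :
  ((c + y)%:E <= l)%E = (y%:E <= l - c%:E)%E.
Proof.
case: l => [l| |]; rewrite ?leey ?leNye //=.
by rewrite -EFinD !lee_fin; apply/idP/idP; lra.
Qed.

Lemma lower_reflect (l : \bar R) (c y : R) :
  (l <= (c + y)%:E)%E = ((- y)%:E <= c%:E - l)%E.
Proof.
case: l => [l| |]; rewrite ?leey ?leNye //=.
by rewrite -EFinD !lee_fin; apply/idP/idP; lra.
Qed.

Lemma upper_reflect (l : \bar R) (c y : R) :
  ((c + y)%:E <= l)%E = (c%:E - l <= (- y)%:E)%E.
Proof.
case: l => [l| |]; rewrite ?leey ?leNye //=.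
by rewrite -EFinD !lee_fin; apply/idP/idP; lra.
Qed.

Lemma bounds_reflection gamma x i : type_preserving gamma ->
  let j := ((gamma^-1)%g (i, false)).1 in
  (lb P i <= (reflection P gamma x 0 i)%:E <= ub P i)%E =
  (lb P j <= (x 0 j)%:E <= ub P j)%E.
Proof.
move=> tgamma; have := tgamma ((gamma^-1)%g (i, false)).
rewrite permKV mxE; case: ((gamma^-1)%g (i, false)) => [j [|]] /=;
  rewrite /var_type /= => -[lE uE _ _]; rewrite ?expr1 ?expr0 ?mul1r ?mulN1r;
  rewrite lower_shift upper_shift lE uE;
  have xE : x 0 j = center P j + (x 0 j - center P j) by rewrite addrC subrK.
- by rewrite [in RHS]xE andbC lower_reflect upper_reflect.
- by rewrite [in RHS]xE [in RHS]lower_shift [in RHS]upper_shift.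
Qed.

Lemma int_reflection gamma x i :
  types_respect_integrality P -> type_preserving gamma ->
  let j := ((gamma^-1)%g (i, false)).1 in i \in ints P ->
  (reflection P gamma x 0 i \is a Num.int) = (x 0 j \is a Num.int).
Proof.
move=> Pint tgamma /= iP; set s := (gamma^-1)%g (i, false).
have eqt : var_type P (i, false) = var_type P s by rewrite -(tgamma s) permKV.
have /= := Pint (i, false) s iP eqt.
rewrite expr0 mul1r mxE /= -/s => cint.
have -> : center P i + (-1) ^+ s.2 * (x 0 s.1 - center P s.1) =
  (center P i - (-1) ^+ s.2 * center P s.1) + (-1) ^+ s.2 * x 0 s.1 by ring.
by rewrite rpredDl // rpredMsign.
Qed.

Lemma ints_reflection gamma i : type_preserving gamma ->
  (((gamma^-1)%g (i, false)).1 \in ints P) = (i \in ints P).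
Proof.
move=> tgamma; have := tgamma ((gamma^-1)%g (i, false)).
rewrite permKV; case: ((gamma^-1)%g (i, false)) => [j [|]];
  by rewrite /var_type /= => -[_ _ _ ->].
Qed.

Lemma objective_reflection gamma x : signed_perm gamma -> type_preserving gamma ->
  objective P (reflection P gamma x) = objective P x.
Proof.
move=> sgamma tgamma.
have objE z : objective P z = \sum_i obj P 0 i * center P i
                              + \sum_i obj P 0 i * centered z 0 i.
  by rewrite -big_split; apply: eq_bigr => i _; rewrite mxE /= -mulrDr addrC subrK.
rewrite !objE; congr (_ + _).
rewrite [RHS](reindex _ (onW_bij _ (signed_index_bij sgamma))) /=.
apply: eq_bigr => i _; rewrite centered_reflection [in LHS]mxE.
have := tgamma ((gamma^-1)%g (i, false)).
rewrite permKV; case: ((gamma^-1)%g (i, false)) => [j [|]];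
  rewrite /var_type /= => -[_ _ -> _]; last by rewrite expr0 mul1r.
by rewrite expr1 mulN1r mulrNN.
Qed.

Lemma type_preserving_reflection_symmetry gamma :
  types_respect_integrality P -> signed_perm gamma -> type_preserving gamma ->
  (forall k x, con P k (reflection P gamma x) = con P k x) ->
  reflection_symmetry P gamma.
Proof.
move=> Pint sgamma tgamma cgamma x; split; last exact: objective_reflection.
have [g gK Kg] := signed_index_bij sgamma.
split=> -[xcon xbd xint]; split.
- by move=> k; rewrite -cgamma.
- by move=> j; rewrite -(Kg j) -bounds_reflection.
- move=> j jP; rewrite -(Kg j) -int_reflection //; last first.
    by rewrite -(ints_reflection _ tgamma) Kg.
  by apply: xint; rewrite -(ints_reflection _ tgamma) Kg.
- by move=> k; rewrite cgamma.
- by move=> i; rewrite bounds_reflection.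
- by move=> i iP; rewrite int_reflection //; apply: xint; rewrite ints_reflection.
Qed.

End Reflections.

(** * Isomorphisms between graphs of expression trees *)

Lemma set2_eqP (T : finType) (a b c d : T) : [set a; b] = [set c; d] ->
  a = c /\ b = d \/ a = d /\ b = c.
Proof.
move=> /setP eqs; have := eqs a; have := eqs b; have := eqs c; have := eqs d.
rewrite !inE !eqxx !orbT /= !(eq_sym c) !(eq_sym d).
move: (a =P c) (a =P d) (b =P c) (b =P d) => [ac|_] [ad|_] [bc|_] [bd|_] //=;
  by [left|right|left; split; congruence].
Qed.

Section TreeGraph.
Variables (R : realType) (O : operators R) (n m : nat) (P : minlp R n m).
Implicit Types t : expr O n.

Lemma dist_node_inj t : injective (dist_node t).
Proof. by move=> s s' []. Qed.

(** Variable leaves have no children. *)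
Lemma parent_neq_dist t (z : place t) s : parent z != dist_node t s.
Proof. by rewrite /parent /parent_node; case: pickP. Qed.

Lemma parent_neq_self t (q : seq_sub (tree_nodes t)) :
  parent (inl q) != inner_node q.
Proof.
apply/eqP => /parent_eq_inner[k] /(congr1 size); rewrite size_rcons; lia.
Qed.

Section Isomorphism.
Variables (t t' : expr O n) (f : gnode t -> gnode t').
Hypothesis fP : @isomorphism _ (tree_graph P t) (tree_graph P t') f.

Let f_bij : bijective f. Proof. by case: fP. Qed.
Let f_inj : injective f. Proof. exact: bij_inj. Qed.
Let f_col u : gncol P (f u) = gncol P u. Proof. by case: fP => _ /(_ u). Qed.

Lemma iso_anchor : f (anchor_node t) = anchor_node t'.
Proof. by have := f_col None; case: (f None) => [[s|q]|] //=; case: (ssval q).2. Qed.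

Lemma iso_dist s : exists s', f (dist_node t s) = dist_node t' s' /\
  var_type P s' = var_type P s.
Proof.
have := f_col (dist_node t s); case: (f _) => [[s'|q]|] //=.
  by case; exists s'.
by case: (ssval q).2.
Qed.

Lemma iso_inner q : exists q', f (inner_node q) = inner_node q' /\
  (ssval q').2 = (ssval q).2.
Proof.
have := f_col (inner_node q); case: (f _) => [[s'|q']|] /=;
  case cE: (ssval q).2 => [b|o] //; case c'E: (ssval q').2 => [b'|o'] // -[<-];
  by exists q'.
Qed.

(** The ends of the image of an edge are the images of its ends, in one of the
    two orders. *)
Lemma iso_edge : exists h : gedge t -> gedge t', [/\ bijective h,
  forall e, (gends (h e)).1 = f (gends e).1 /\ (gends (h e)).2 = f (gends e).2 \/
            (gends (h e)).1 = f (gends e).2 /\ (gends (h e)).2 = f (gends e).1 &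
  forall e, gecol (h e) = gecol e].
Proof.
case: fP => _ _ [h [h_bij h_ends h_col]]; exists h; split=> // e.
have := h_ends e; rewrite /endset imsetU1 imset_set1.
exact: set2_eqP.
Qed.

Lemma iso_sneg s s' : f (dist_node t s) = dist_node t' s' ->
  f (dist_node t (sneg s)) = dist_node t' (sneg s').
Proof.
case: iso_edge => h [_ h_ends h_col] fs.
have [s1 [fs1 _]] := iso_dist (sneg s).
have := h_ends (inl (inl s.1)); have := h_col (inl (inl s.1)).
case: s fs fs1 => i b; rewrite /sneg /= => fs fs1.
case: (h _) => [[j|q]|[l c]] //= _; last first.
  by case: b fs fs1 => /= -> ->; case=> -[].
by case: b fs fs1 => /= -> ->; case=> -[[<-] [<-]].
Qed.

Lemma iso_signed_perm : exists gamma : {perm signed n},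
  [/\ signed_perm gamma, forall s, f (dist_node t s) = dist_node t' (gamma s) &
      type_preserving P gamma].
Proof.
have [g gP] := choice iso_dist.
have g_inj : injective g.
  move=> s s' eq_g; apply/dist_node_inj/f_inj.
  by rewrite (gP s).1 (gP s').1 eq_g.
exists (perm g_inj); split=> s; rewrite !permE; last 2 first.
- exact: (gP s).1.
- exact: (gP s).2.
by have := iso_sneg (gP s).1; rewrite (gP (sneg s)).1 => /dist_node_inj.
Qed.

(** Arcs entering inner nodes keep their orientation.  By induction on the depth
    of [q], the edge entering [q] is mapped to the edge entering the image of
    [q]: otherwise it would be mapped to the edge entering the image of the
    parent of [q], which is already the image of another edge. *)
Lemma iso_parent_inner q q' : f (inner_node q) = inner_node q' ->
  parent (inl q') = f (parent (inl q)).
Proof.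
case: iso_edge => h [h_bij h_ends h_col].
have h_inner r : exists r', h (inl (inr r)) = inl (inr r').
  have := h_ends (inl (inr r)); have := h_col (inl (inr r)).
  have [r1 [fr _]] := iso_inner r.
  case: (h _) => [[j|r']|[l b]] //= _; last by exists r'.
  by rewrite fr => -[[]|[]].
suff main r r' : f (inner_node r) = inner_node r' -> h (inl (inr r)) = inl (inr r').
  move=> fq; have := h_ends (inl (inr q)); rewrite (main _ _ fq) /=.
  case=> [[//]|[]]; rewrite fq => /eqP eqq.
  by have := parent_neq_self q'; rewrite /parent eqq.
have [d] := ubnP (size (position (inl r))).
elim: d r r' => // d ih r r' ltd fr.
have [r1 hr] := h_inner r; rewrite hr.
have := h_ends (inl (inr r)); rewrite hr /= fr => -[[_ [->//]]|[pr1 fpr]].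
(* From here on [h] reverses the arc entering [r]; this is to be refuted. *)
have [r0|[q0 [k rk]]] := position_cases (inl r).
  have := fpr; rewrite -[parent_node t _]/(parent (inl r)).
  by move/parent_eq_anchor: r0 => ->; rewrite iso_anchor.
have pr : parent (inl r) = inner_node q0 by apply/parent_eq_inner; exists k.
have fq0 : f (inner_node q0) = inner_node r1 by rewrite -pr fpr.
have := ih q0 r1; rewrite -hr => /(_ _ fq0) hq0.
have /(bij_inj h_bij)[q0r] : h (inl (inr q0)) = h (inl (inr r)).
  by apply: hq0; move: ltd; rewrite rk size_rcons ltnS.
by have := parent_neq_self r; rewrite pr q0r eqxx.
Qed.

(** The isomorphism as a bijection between tree places, variable leaves
    included.  It commutes with parents, keeps the content of inner nodes, and
    the value of a leaf at [y] is the value of its image at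
    [signed_act gamma y]. *)
Lemma iso_place gamma : signed_perm gamma ->
  (forall s, f (dist_node t s) = dist_node t' (gamma s)) ->
  exists F : place t -> place t', [/\ bijective F,
    forall z, parent (F z) = f (parent z),
    forall q, exists q', [/\ F (inl q) = inl q', f (inner_node q) = inner_node q'
      & (ssval q').2 = (ssval q).2] &
    forall l, exists l', F (inr l) = inr l' /\ forall y : 'rV[R]_n,
      (ssval l').2.1 * signed_act gamma y 0 (ssval l').2.2
      = (ssval l).2.1 * y 0 (ssval l).2.2].
Proof.
move=> sgamma fgamma.
have [Fq FqP] := choice iso_inner.
case: iso_edge => h [h_bij h_ends h_col].
(* The image of a leaf is defined by its edge to v_i alone; its edge to v_-i may
   be mapped to an edge of another leaf with the same parent, coefficient and
   variable. *)
have h_leaf (l : seq_sub (var_leaves t)) :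
    exists lb : seq_sub (var_leaves t') * bool,
    [/\ h (inr (l, false)) = inr lb, parent (inr lb.1) = f (parent (inr l)),
        gamma ((ssval l).2.2, false) = ((ssval lb.1).2.2, lb.2) &
        (ssval l).2.1 = (-1) ^+ lb.2 * (ssval lb.1).2.1].
  have := h_ends (inr (l, false)); have := h_col (inr (l, false)).
  case hl: (h _) => [//|[l' b]] /= -[aE] ends_l; exists (l', b); split => //=.
  - case: ends_l => -[] //; rewrite fgamma => /eqP pl.
    by have := parent_neq_dist (inr l') (gamma ((ssval l).2.2, false));
      rewrite /parent pl.
  - case: ends_l => -[]; rewrite fgamma; first by move=> _ /dist_node_inj.
    move=> /eqP pl.
    by have := parent_neq_dist (inr l') (gamma ((ssval l).2.2, false));
      rewrite /parent pl.
  - by rewrite aE expr0 mul1r.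
have [Fl FlP] := choice h_leaf.
pose F (z : place t) : place t' :=
  match z with inl q => inl (Fq q) | inr l => inr (Fl l).1 end.
have F_inj : injective F.
  case=> [q|l] [q'|l'] //= [].
  - move=> eqF; congr inl; suff [] : inner_node q = inner_node q' by [].
    by apply: f_inj; rewrite (FqP q).1 (FqP q').1 eqF.
  - have [hl _ gl _] := FlP l; have [hl' _ gl' _] := FlP l' => eqF.
    have [eqb|neqb] := eqVneq (Fl l).2 (Fl l').2.
      have /(bij_inj h_bij)[->//] : h (inr (l, false)) = h (inr (l', false)).
      by rewrite hl hl'; congr inr; apply/eqP; rewrite -pair_eqE /= eqF eqb !eqxx.
    (* The two edges of one leaf of [t'] end at opposite distinguished nodes, so
       the edges mapped to them do as well; but the edges chosen for [l] and
       [l'] both end at unreflected variables. *)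
    have : gamma (sneg ((ssval l).2.2, false)) = gamma ((ssval l').2.2, false).
      rewrite sgamma gl gl' eqF /sneg /=.
      by case: (Fl l).2 (Fl l').2 neqb => [] [].
    by move/perm_inj.
exists F; split.
(* Counting nodes shows that the trees have equally many inner nodes, counting
   edges that they have equally many variable leaves. *)
- apply: inj_card_bij => //.
  have := bij_eq_card f_bij; have := bij_eq_card h_bij.
  rewrite /place /gnode /gedge !card_option !card_sum !card_prod !card_bool; lia.
- case=> [q|l]; last by have [] := FlP l.
  exact: iso_parent_inner (FqP q).1.
- by move=> q; exists (Fq q); have [] := FqP q.
- move=> l; exists (Fl l).1; split=> // y.
  have [_ _ gl aE] := FlP l.
  have := signed_actE y ((ssval l).2.2, false) sgamma; rewrite gl /= expr0 mul1r => <-.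
  by rewrite aE mulrACA -expr2 sqrr_sign mul1r.
Qed.

(** Isomorphic graphs represent the same function up to a signed permutation. *)
Lemma iso_eval gamma : commutative_tree t -> signed_perm gamma ->
  (forall s, f (dist_node t s) = dist_node t' (gamma s)) ->
  forall y, eval (signed_act gamma y) t' = eval y t.
Proof.
move=> ct sgamma fgamma y.
have [F [F_bij F_parent F_inner F_leaf]] := iso_place sgamma fgamma.
suff main u z : subtree t (position z) = Some u ->
    value (signed_act gamma y) (F z) = eval y u.
  have [z0 z0E] : exists z : place t, position z = [::] by exact: position_onto.
  have Fz0 : position (F z0) = [::].
    apply/parent_eq_anchor; rewrite F_parent.
    by move/parent_eq_anchor: z0E => ->; exact: iso_anchor.
  by rewrite -(main t z0) ?z0E // /value Fz0.
elim/expr_nested_ind: u z => [a i|b|o ts ih] z zE.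
- case: z zE => [q|l] zE;
    [have := subtree_position (inl q)|have := subtree_position (inr l)];
    rewrite zE => -[_ [<-] //=].
  case=> lE; have [l' [Fl actE]] := F_leaf l.
  rewrite /value Fl; have [u' -> /=] := subtree_position (inr l').
  case: u' => //= a' i' -[l'E].
  by have := actE y; rewrite -lE -l'E.
- case: z zE => [q|l] zE;
    [have := subtree_position (inl q)|have := subtree_position (inr l)];
    rewrite zE => -[_ [<-] //=].
  case=> qE; have [q' [Fq _ cE]] := F_inner q.
  rewrite /value Fq; have [u' -> /=] := subtree_position (inl q').
  by rewrite /= cE -qE; case: u' => //= b' -[->].
- case: z zE => [q|l] zE;
    [have := subtree_position (inl q)|have := subtree_position (inr l)];
    rewrite zE => -[_ [<-] //=].
  case=> qE; have [q' [Fq fq cE]] := F_inner q.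
  rewrite /value Fq; have [u' q'E] := subtree_position (inl q').
  rewrite q'E /= cE -qE; case: u' q'E => // o' ts' q'E [oE].
  rewrite /= {}oE in q'E *.
  have cts := commutative_subtree ct zE.
  inversion cts as [| |o1 ts1 comm_o _ [eqo eqts]]; subst.
  (* Both argument lists consist of the values of the children, and [F] maps the
     children of [q] onto those of [q']. *)
  symmetry; apply: comm_o; first by rewrite size_map.
  rewrite (perm_trans (perm_children y zE)) // perm_sym.
  rewrite (perm_trans (perm_children _ q'E)) //.
  apply: (@perm_trans _ [seq value (signed_act gamma y) w | w <-
            [seq F z | z <- enum (place t) & parent z == inner_node q]]).
    apply: perm_map; apply: uniq_perm.
    - by rewrite filter_uniq ?enum_uniq.
    - by rewrite (map_inj_uniq (bij_inj F_bij)) filter_uniq ?enum_uniq.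
    have [G FK GK] := F_bij.
    move=> w; rewrite -[w]GK (mem_map (bij_inj F_bij)).
    rewrite mem_filter [RHS]mem_filter !mem_enum.
    by rewrite F_parent -fq (inj_eq f_inj).
  rewrite -map_comp (eq_in_map _ (value y) _).1 // => z; rewrite mem_filter => /andP[].
  move=> /eqP/parent_eq_inner[k zk] _ /=.
  have [u zu _] := subtree_position z.
  rewrite /value zu; move: zu; rewrite zk subtree_rcons zE.
  case: ifP => // ltk [<-] /=.
  by apply: ih; rewrite // zk subtree_rcons zE ltk.
Qed.

End Isomorphism.

(** * Paths from the anchor *)

Lemma inner_path_parent t (z : place t) : exists p,
  [/\ path (@adj _ (tree_graph P t)) (anchor_node t) p,
      last (anchor_node t) p = parent z &
      forall w, w \in p -> w \notin distinguished (G := tree_graph P t) (dist_node t)].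
Proof.
have [d] := ubnP (size (position z)); elim: d z => // d ih z ltd.
have [z0|[q [k zk]]] := position_cases z.
  by exists [::]; split=> //=; apply/esym/parent_eq_anchor.
have -> : parent z = inner_node q by apply/parent_eq_inner; exists k.
have [|p [pp lp dp]] := ih (inl q); first by move: ltd; rewrite zk size_rcons.
exists (rcons p (inner_node q)); split; rewrite ?last_rcons //.
- rewrite rcons_path pp lp /=; apply/existsP.
  by exists (inl (inr q) : edge (tree_graph P t)).
- move=> w; rewrite mem_rcons inE => /orP[/eqP->|/dp//].
  by apply/imsetP => -[].
Qed.

Lemma tree_graph_anchored_on t :
  anchored_on (G := tree_graph P t) (dist_node t) (fun i => occurs i t).
Proof.
exists (anchor_node t); split=> [|u neq_u used_u]; first by apply/imsetP => -[].
case: u neq_u used_u => [[s|q]|] // _ used_u.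
- have [p [a pE]] := subtree_occurs (used_u s erefl).
  have [z zE] := position_onto pE.
  have [u0] := subtree_position z; rewrite zE pE => -[<-] /=.
  case: z zE => // l zE [lE].
  have [p' [pp lp dp]] := inner_path_parent (inr l).
  exists p'; split=> //; rewrite rcons_path pp lp /=; apply/existsP.
  exists (inr (l, s.2) : edge (tree_graph P t)).
  by rewrite /endset /= -lE /= -surjective_pairing.
- have [p' [pp lp dp]] := inner_path_parent (inl q).
  exists p'; split=> //; rewrite rcons_path pp lp /=; apply/existsP.
  by exists (inl (inr q) : edge (tree_graph P t)).
Qed.

End TreeGraph.

(** * Consequences for a preprocessed program *)

Section Program.
Variables (R : realType) (O : operators R) (n m : nat) (P : minlp R n m).
Implicit Types t : expr O n.

Lemma tree_graph_connected t :
  (forall i, occurs i t) -> connected (tree_graph P t).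
Proof.
move=> occ; have [a [_ aP]] := tree_graph_anchored_on P t.
have adj_sym : symmetric (@adj _ (tree_graph P t)).
  by move=> u w; rewrite /adj setUC.
have a_conn u : connect (@adj _ (tree_graph P t)) a u.
  have [->|neq_u] := eqVneq u a; first exact: connect0.
  have [|p [pp _]] := aP u neq_u; first by move=> s _; apply: occ.
  by apply/connectP; exists (rcons p u); rewrite ?last_rcons.
move=> u w; apply: connect_trans (a_conn w).
by rewrite (sym_connect_sym adj_sym).
Qed.

Lemma tree_graph_iso_con t0 t0' t t' k k' (f : gnode t -> gnode t') :
  represents t0 (con P k) -> preprocessed P t0 t -> commutative_tree t ->
  represents t0' (con P k') -> preprocessed P t0' t' ->
  @isomorphism _ (tree_graph P t) (tree_graph P t') f ->
  exists gamma : {perm signed n},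
    [/\ signed_perm gamma, type_preserving P gamma,
        forall s, f (dist_node t s) = dist_node t' (gamma s) &
        forall y, centered_con P k' (signed_act gamma y) = centered_con P k y].
Proof.
move=> t0E t0t ct t0E' t0t' fP.
have [gamma [sgamma fgamma tgamma]] := iso_signed_perm fP.
exists gamma; split=> // y.
by rewrite -(eval_preprocessed _ t0E t0t) -(eval_preprocessed _ t0E' t0t')
  (iso_eval fP).
Qed.

Lemma con_reflection gamma k k' x :
  (forall y, centered_con P k' (signed_act gamma y) = centered_con P k y) ->
  con P k' (reflection P gamma x) = con P k x.
Proof. by move=> conE; rewrite !con_centered centered_reflection conE. Qed.

Lemma tree_graph_automorphisms t0 t k :
  types_respect_integrality P ->
  represents t0 (con P k) -> preprocessed P t0 t -> commutative_tree t ->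
  automorphisms_are_symmetries (G := tree_graph P t) (dist_node t) (only_con P k).
Proof.
move=> Pint t0E t0t ct f fP.
have [gamma [sgamma tgamma fgamma conE]] := tree_graph_iso_con t0E t0t ct t0E t0t fP.
split; last 1 first.
- exists gamma; split=> //.
  apply: (@type_preserving_reflection_symmetry _ _ _ (only_con P k)) => // k0 x.
  exact: con_reflection.
- apply/eqP; rewrite eqEcard card_imset ?leqnn ?andbT; last first.
    by case: fP => /bij_inj.
  apply/subsetP => _ /imsetP[_ /imsetP[s _ ->] ->].
  by rewrite fgamma; apply/imsetP; exists (gamma s).
- by move=> s s'; rewrite !fgamma => /dist_node_inj <-; rewrite sgamma.
Qed.

(** If types tell variables from reflected variables, then a type-preserving
    signed permutation keeps all signs. *)
Lemma signed_act_permute gamma :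
  (forall i j, var_type P (i, false) <> var_type P (j, true)) ->
  type_preserving P gamma ->
  exists pi : 'S_n, forall y : 'rV[R]_n, signed_act gamma y = permute pi y.
Proof.
move=> types tgamma.
have pos i : gamma (i, false) = ((gamma (i, false)).1, false).
  have := tgamma (i, false); case: (gamma _) => [j []] //= eqt.
  by case: (types i j).
have inj : injective (fun i => (gamma (i, false)).1).
  by move=> i j eq_ij; have /perm_inj[] : gamma (i, false) = gamma (j, false);
    rewrite // pos [RHS]pos eq_ij.
exists (perm inj) => y; apply/rowP => i; rewrite !mxE.
have -> : (gamma^-1)%g (i, false) = (((perm inj)^-1)%g i, false).
  apply: (canLR (permK gamma)); rewrite pos; congr pair.
  by have := permKV (perm inj) i; rewrite permE.
by rewrite /= expr0 mul1r.
Qed.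

End Program.

Theorem proposition4p3 (R : realType) (n m : nat) (O : operators R)
    (P : minlp R n m) (T0 T : 'I_m -> expr O n)
    (n_gt0 : (0 < n)%N) (m_gt0 : (0 < m)%N)
    (T0_con : forall k, represents (T0 k) (con P k))
    (T0_T : forall k, preprocessed P (T0 k) (T k))
    (T_comm : forall k, commutative_tree (T k))
    (P_int : types_respect_integrality P) :
  let G := fun k => tree_graph P (T k) in
  let v := fun k (s : signed n) => dist_node (T k) s : node (G k) in
  [/\ forall k, (forall i, occurs i (T k)) ->
        is_sdg (v k) (only_con P k) /\ anchored (v k),
      forall k, [/\ injective (v k),
        automorphisms_are_symmetries (v k) (only_con P k) &
        anchored_on (v k) (fun i => occurs i (T k))],
      forall k, variable_color_compatible P (v k),
      forall k k', constraint_compatible (G k) (G k')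
        (reflection_equiv P (con P k) (con P k')) &
      (forall i j, var_type P (i, false) <> var_type P (j, true)) ->
      forall k k', constraint_compatible (G k) (G k')
        (perm_equiv (centered_con P k) (centered_con P k'))].
Proof.
move=> G v.
have anch k : anchored_on (v k) (fun i => occurs i (T k)).
  exact: tree_graph_anchored_on.
have auto k : automorphisms_are_symmetries (v k) (only_con P k).
  exact: tree_graph_automorphisms (T0_con k) (T0_T k) (T_comm k).
have iso k k' (f : node (G k) -> node (G k')) (fP : isomorphism f) :=
  tree_graph_iso_con (T0_con k) (T0_T k) (T_comm k) (T0_con k') (T0_T k') fP.
split.
- move=> k occ; split.
    by split; [exact: tree_graph_connected|exact: dist_node_inj|].
  have [a [a_inner aP]] := anch k; exists a; split=> // u neq_u.
  by apply: aP => // s _; apply: occ.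
- by move=> k; split=> //; exact: dist_node_inj.
- move=> k; split=> // -[[s|q]|] u_inner s' //=.
    by move: u_inner => /imsetP[]; exists s.
  by case: (ssval q).2.
- move=> k k'; have [[f fP]|] := EM (isomorphic (G k) (G k')); last by left.
  have [gamma [sgamma _ _ conE]] := iso k k' f fP.
  right; exists gamma; split=> // x; apply/esym; exact: con_reflection.
- move=> types k k'; have [[f fP]|] := EM (isomorphic (G k) (G k')); last by left.
  have [gamma [_ tgamma _ conE]] := iso k k' f fP.
  have [pi piE] := signed_act_permute types tgamma.
  by right; exists pi => y; rewrite -piE conE.
Qed.
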